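(* For all positive integers $p>1$ and $q$, \begin{align*} (1+(-1)^{p+q})\bar T_{p,q}&=(-1)^{p+q}\bar t(p+q)+(-1)^{p}(1-(-1)^q)\widetilde{t}(p)\bar t(q)\\ &\quad+(-1)^p\sum_{k=0}^{p-1} ((-1)^k+1)\binom{p+q-k-2}{q-1}\bar t(k+1)\zeta(\overline{p+q-k-1})\\ &\quad-2(-1)^p\sum_{\substack{2k_1+k_2=q-1\\ k_1,k_2\geq 0}}\binom{p+k_2-1}{p-1}\bar t(2k_1+1)\zeta(p+k_2). \end{align*}
   Context: Let $h_n^{(p)}=\sum_{k=1}^n (k-1/2)^{-p}$ for $n\ge0$. The alternating Euler $T$-sum is $\bar T_{p,q}=\sum_{n\ge1}\frac{h_{n-1}^{(p)}}{(n-1/2)^q}(-1)^n$. For $s\ge1$, $\bar t(s)=\sum_{n\ge1}\frac{(-1)^{n-1}}{(n-1/2)^s}$; $\zeta(\bar s)=\sum_{n\ge1}\frac{(-1)^n}{n^s}$; $\widetilde t(p)=\sum_{n\ge1}(n-1/2)^{-p}=(2^p-1)\zeta(p)$; $\zeta$ is the Riemann zeta function. *)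

(* Defs.v *)
From mathcomp Require Import all_boot all_order all_algebra.
From mathcomp Require Import all_classical all_reals topology normedtype sequences.

Set Implicit Arguments.
Unset Strict Implicit.
Unset Printing Implicit Defensive.

Import Order.TTheory GRing.Theory Num.Theory.
Import numFieldNormedType.Exports.

Local Open Scope ring_scope.
Local Open Scope classical_set_scope.

(* The limit of the partial sums u 1 + ... + u (N - 1): this covers the
   series below that converge only conditionally. *)
Definition sum_ge1 (R : realType) (u : nat -> R) : R :=
  limn (fun N => \sum_(1 <= n < N) u n).

Definition hnum (R : realType) (p n : nat) : R :=
  \sum_(1 <= k < n.+1) (k%:R - 2^-1) ^- p.

Definition Tbar (R : realType) (p q : nat) : R :=
  sum_ge1 (fun n => hnum R p n.-1 / (n%:R - 2^-1) ^+ q * (-1) ^+ n).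

Definition tbar (R : realType) (s : nat) : R :=
  sum_ge1 (fun n => (-1) ^+ n.-1 / (n%:R - 2^-1) ^+ s).

Definition ttilde (R : realType) (p : nat) : R :=
  sum_ge1 (fun n => (n%:R - 2^-1) ^- p).

Definition zeta (R : realType) (s : nat) : R :=
  sum_ge1 (fun n => n%:R ^- s).

(* zeta at a barred argument *)
Definition zetabar (R : realType) (s : nat) : R :=
  sum_ge1 (fun n => (-1) ^+ n / n%:R ^+ s).

(* Main.v *)
Require Import Defs.
From mathcomp Require Import all_boot all_order all_algebra.
From mathcomp Require Import all_classical all_reals topology normedtype sequences.
From mathcomp Require Import ring lra zify.

(** Let [x] run over the half-integers [n - 1/2], [n] in Z, with the sign
    [e(x) = (-1)^n], which is odd in [x].  The sum over [x] and over the
    integers [m >= 1] of [e(x) x^-q (m - x)^-p] is computed in two ways.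
    Summing over [m] first, the inner sum is [ttilde p + (-1)^p h_(n-1)] at
    [x = n - 1/2] and [ttilde p - h_n] at [x = -(n - 1/2)], which produces the
    terms in [Tbar p q], [tbar (p + q)] and [ttilde p * tbar q].  Summing over
    [x] first, the partial fraction expansion in [x] and the invariance of
    [e(x) x^-j] under integer shifts (up to sign) reduce every inner sum to
    the bilateral sum of [e(x) x^-j], leaving [zeta] and [zetabar] in [m].
    For [q = 1] the double series is not absolutely convergent; the exchange
    is justified by Abel summation in [x] applied to the tails over [m >= M],
    which bounds them by O(1/M) plus tails of [ttilde p], uniformly in the
    truncation of [x]. *)

Import Order.TTheory GRing.Theory Num.Theory.
Import numFieldNormedType.Exports.

Local Open Scope ring_scope.
Local Open Scope classical_set_scope.

(** * Half-integers *)

Definition hint (R : realType) (n : nat) : R := n%:R - 2^-1.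

Lemma hintS (R : realType) (n : nat) : hint R n.+1 = hint R n + 1.
Proof. by rewrite /hint -natr1; ring. Qed.

Lemma hint_ge (R : realType) (n : nat) : (0 < n)%N -> 2^-1 <= hint R n.
Proof.
move=> n0; rewrite /hint.
have : (1 : R) <= n%:R by rewrite ler1n.
by lra.
Qed.

Lemma hint_gt0 (R : realType) (n : nat) : (0 < n)%N -> 0 < hint R n.
Proof. by move=> /(hint_ge R); apply: lt_le_trans; rewrite invr_gt0. Qed.

Lemma hint_neq0 (R : realType) (n : nat) : hint R n != 0.
Proof.
case: n => [|n]; last by rewrite gt_eqF// hint_gt0.
by rewrite /hint lt_eqF//; lra.
Qed.

Lemma subnat_hint_ge (R : realType) (m n : nat) : 2^-1 <= `|m%:R - hint R n|.
Proof.
rewrite /hint; have [mn|nm] := ltnP m n.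
- have : (m%:R + 1 : R) <= n%:R by rewrite natr1 ler_nat.
  by move=> H; rewrite ler0_norm; lra.
- have : (n%:R : R) <= m%:R by rewrite ler_nat.
  by move=> H; rewrite ger0_norm; lra.
Qed.

Lemma subnat_hint_neq0 (R : realType) (m n : nat) : m%:R - hint R n != 0.
Proof.
rewrite -normr_eq0 gt_eqF//.
by apply: lt_le_trans (subnat_hint_ge R m n); rewrite invr_gt0.
Qed.

Lemma addnat_hint_neq0 (R : realType) (m n : nat) : m%:R + hint R n != 0.
Proof.
have -> : m%:R + hint R n = hint R (m + n) by rewrite /hint natrD; ring.
exact: hint_neq0.
Qed.

(** * Alternating sums, Abel summation and convergence criteria *)

(** Multiplied by [(-1) ^+ k], the sum from [k] is [u k] minus the likewise normalised sum from
    [k.+1], so by induction on the number of terms it stays between 0 and [u k]. *)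
Lemma alternating_tail {R : realDomainType} {u : nat -> R} {k : nat} (N : nat) :
  (forall n, (k <= n)%N -> 0 <= u n) ->
  (forall n, (k <= n)%N -> u n.+1 <= u n) ->
  `|\sum_(k <= n < N) (-1) ^+ n * u n| <= u k.
Proof.
move=> u0 du.
have [Nk|kN] := leqP N k; first by rewrite big_geq// normr0 u0.
suff: 0 <= (-1) ^+ k * \sum_(k <= n < N) (-1) ^+ n * u n <= u k.
  move=> /andP[S0 Sk]; rewrite -(ger0_norm S0) in Sk.
  by rewrite normrM normrX normrN1 expr1n mul1r in Sk.
rewrite -(subnKC (ltnW kN)); move: (N - k)%N => d {N kN}.
elim: d k u0 du => [|d IH] k u0 du.
  by rewrite addn0 big_geq// mulr0 lexx u0.
rewrite big_ltn ?addnS ?ltnS ?leq_addr// -addSn mulrDr mulrA -exprMn mulrNN.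
rewrite mulr1 expr1n mul1r.
have /andP[] := IH k.+1 (fun n h => u0 n (ltnW h)) (fun n h => du n (ltnW h)).
rewrite exprS mulN1r mulNr => A0 Ak.
by apply/andP; split; have := du k (leqnn k); lra.
Qed.

(** Summation by parts against the tail sums of [c] rather than its initial sums: for an alternating
    [c], [alternating_tail] makes each tail as small as its first term. *)
Lemma abel_summation {R : comPzRingType} (c w : nat -> R) (k N : nat) : (k < N)%N ->
  \sum_(k <= n < N) c n * w n =
  w k * (\sum_(k <= n < N) c n)
  + \sum_(k.+1 <= i < N) (w i - w i.-1) * \sum_(i <= n < N) c n.
Proof.
move=> kN; rewrite -(subnKC kN); move: (N - k.+1)%N => d {N kN}.
elim: d k => [|d IH] k.
  by rewrite addn0 !big_nat1 big_geq// addr0 mulrC.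
have lt1 e : (k < k.+1 + e)%N by rewrite addSn ltnS leq_addr.
rewrite big_ltn// addnS -addSn IH.
rewrite [in RHS](@big_ltn _ _ _ k); last by lia.
rewrite [X in _ = _ + X]big_ltn; last by lia.
by rewrite /=; ring.
Qed.

Lemma abel_bound {R : realDomainType} {u w : nat -> R} (k N : nat) : (k < N)%N ->
  (forall n, (k <= n)%N -> 0 <= u n) ->
  (forall n, (k <= n)%N -> u n.+1 <= u n) ->
  `|\sum_(k <= n < N) (-1) ^+ n * u n * w n| <=
  u k * `|w k| + \sum_(k.+1 <= i < N) u i * `|w i - w i.-1|.
Proof.
move=> kN u0 du.
rewrite (abel_summation (fun n => (-1) ^+ n * u n))//.
apply: le_trans (ler_normD _ _) _; apply: lerD.
  by rewrite normrM mulrC ler_wpM2r// alternating_tail.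
rewrite (le_trans (ler_norm_sum _ _ _))//.
apply: ler_sum_nat => i /andP[ki _]; rewrite normrM mulrC ler_wpM2r//.
apply: alternating_tail => n ni; [apply: u0|apply: du];
  exact: leq_trans (ltnW ki) ni.
Qed.

Lemma cvg_sum_of_tail {R : realType} {v c : nat -> R} :
  c @ \oo --> (0 : R) ->
  (forall k N, (0 < k)%N -> (k < N)%N -> `|\sum_(k <= n < N) v n| <= c k) ->
  cvgn (fun N => \sum_(1 <= n < N) v n).
Proof.
move=> c0 tail.
(* [series] starts at index 0, so the Cauchy criterion is applied to the shifted terms. *)
have /cvg_ex[l vl] : cvgn (series (fun n => v n.+1)).
  apply/cauchy_cvgP/cauchy_seriesP => e e0.
  have c0' : (fun n => c n.+1) @ \oo --> (0 : R) by rewrite cvg_shiftS.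
  have cl : \forall n \near \oo, `|c n.+1| < e by apply: cvgr0_norm_lt.
  exists ([set n | `|c n.+1| < e], setT) => /=; first by split => //; exact: filterT.
  move=> [m n] /= [cm _].
  have [nm|mn] := leqP n m; first by rewrite big_geq// normr0.
  have -> : \sum_(m <= k < n) v k.+1 = \sum_(m.+1 <= k < n.+1) v k by rewrite big_add1.
  rewrite (le_lt_trans (tail _ _ _ _))//.
  by rewrite (le_lt_trans (ler_norm _)).
apply/cvg_ex; exists l; rewrite -cvg_shiftS.
apply: cvg_trans vl; apply: near_eq_cvg; near=> N.
by rewrite /series /= big_add1.
Unshelve. all: by end_near. Qed.

Lemma sum_ge1_cvg {R : realType} {u f : nat -> R} {l : R} :
  f @ \oo --> l -> (forall N, \sum_(1 <= n < N) u n = f N) -> sum_ge1 u = l.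
Proof. by move=> fl /funext uf; rewrite /sum_ge1 uf; apply: cvg_lim. Qed.

Lemma cvg_alternating {R : realType} {u : nat -> R} :
  u @ \oo --> (0 : R) ->
  (forall n, (0 < n)%N -> 0 <= u n) ->
  (forall n, (0 < n)%N -> u n.+1 <= u n) ->
  cvgn (fun N => \sum_(1 <= n < N) (-1) ^+ n * u n).
Proof.
move=> uto0 u0 du; apply: (cvg_sum_of_tail uto0) => k N k0 kN.
by apply: alternating_tail => n kn; [apply: u0|apply: du]; exact: leq_trans kn.
Qed.

Lemma cvg_sum_nonneg {R : realType} {v : nat -> R} (C : R) :
  (forall n, (0 < n)%N -> 0 <= v n) ->
  (forall N, \sum_(1 <= n < N) v n <= C) ->
  cvgn (fun N => \sum_(1 <= n < N) v n).
Proof.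
move=> v0 vC; apply: nondecreasing_is_cvgn; last by exists C => _ [N _ <-].
apply: homo_leq => [//||n]; first by move=> y x z; exact: le_trans.
case: n => [|n]; first by rewrite !big_geq.
by rewrite (@big_nat_recr _ _ _ n.+1)//= lerDl v0.
Qed.

(** * Elementary bounds and convergence of the defining series *)

(** Each surplus factor [x^-1] is at most 2. This lowers exponents to 0, 1 or 2 at the cost of a
    power of 2. *)
Lemma invX_le {R : realType} (x : R) (j s : nat) : 2^-1 <= x -> (j <= s)%N ->
  x ^- s <= 2 ^+ (s - j) * x ^- j.
Proof.
move=> x2 js; have x0 : 0 < x by apply: lt_le_trans x2; rewrite invr_gt0.
rewrite -{1}(subnK js) exprD invfM ler_wpM2r ?invr_ge0 ?exprn_ge0 ?(ltW x0)//.
by rewrite -exprVn lerXn2r ?nnegrE ?invr_ge0 ?(ltW x0)// -[leRHS]invrK lef_pV2 ?posrE ?invr_gt0.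
Qed.

Lemma natV_le_hintV (R : realType) (n s : nat) : (0 < n)%N ->
  (n%:R : R) ^- s <= hint R n ^- s.
Proof.
move=> n0; have h0 := hint_gt0 R n n0.
rewrite -!exprVn lerXn2r ?nnegrE ?invr_ge0 ?ler0n ?(ltW h0)//.
by rewrite lef_pV2 ?posrE ?ltr0n// /hint; lra.
Qed.

Lemma hintV_noninc (R : realType) (m n s : nat) : (0 < m)%N -> (m <= n)%N ->
  hint R n ^- s <= hint R m ^- s.
Proof.
move=> m0 mn; have h0 := hint_gt0 R m m0.
have h1 : hint R m <= hint R n by rewrite lerD2r ler_nat.
have h0' := lt_le_trans h0 h1.
by rewrite lef_pV2 ?posrE ?exprn_gt0// lerXn2r ?nnegrE// ltW.
Qed.

Lemma hintV_ge0 (R : realType) (n s : nat) : (0 < n)%N -> 0 <= hint R n ^- s.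
Proof. by move=> n0; rewrite invr_ge0 exprn_ge0// ltW// hint_gt0. Qed.

Lemma cvg_hintV (R : realType) (s : nat) : (0 < s)%N ->
  (fun n => hint R n ^- s) @ \oo --> (0 : R).
Proof.
move=> s0; rewrite -cvg_shiftS.
apply: (@squeeze_cvgr _ _ _ _ (fun=> 0) (fun n => 2 ^+ s * harmonic n)).
- near=> n; rewrite hintV_ge0//=.
  rewrite (le_trans (invX_le _ 1 s (hint_ge R n.+1 isT) s0))//.
  rewrite -[in leRHS](subnK s0) exprD -mulrA ler_wpM2l ?exprn_ge0// !expr1.
  rewrite -[2 in leRHS]invrK -invfM lef_pV2 ?posrE ?mulr_gt0 ?invr_gt0 ?hint_gt0//.
  have n1 : (1 : R) <= n.+1%:R by rewrite ler1n.
  by rewrite /hint; lra.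
- exact: cvg_cst.
- rewrite -[X in _ --> X](mulr0 (2 ^+ s)).
  by apply: cvgMl_tmp; exact: cvg_harmonic.
Unshelve. all: by end_near. Qed.

Lemma cvg_natV (R : realType) (s : nat) : (0 < s)%N ->
  (fun n => n%:R ^- s) @ \oo --> (0 : R).
Proof.
move=> s0.
apply: (@squeeze_cvgr _ _ _ _ (fun=> 0) (fun n => hint R n ^- s)).
- near=> n; rewrite invr_ge0 exprn_ge0//= natV_le_hintV//.
  by near: n; exact: nbhs_infty_gt.
- exact: cvg_cst.
- exact: cvg_hintV.
Unshelve. all: by end_near. Qed.

Lemma hnum0 (R : realType) (p : nat) : hnum R p 0 = 0.
Proof. by rewrite /hnum big_geq. Qed.

Lemma hnumS (R : realType) (p n : nat) :
  hnum R p n.+1 = hnum R p n + hint R n.+1 ^- p.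
Proof. by rewrite /hnum big_nat_recr. Qed.

Lemma hnum2_le (R : realType) (n : nat) : hnum R 2 n <= 5.
Proof.
case: n => [|n]; first by rewrite /hnum big_geq.
(* The sharper bound is inductive because [(x + 1/2)^2 >= x (x + 1)] and [1/(x (x + 1))] telescopes;
   the first term 4 dictates the constant 5. *)
suff : hnum R 2 n.+1 <= 5 - n.+1%:R^-1.
  by move=> h; rewrite (le_trans h)// gerBl invr_ge0.
elim: n => [|n IH].
  rewrite /hnum big_nat1 invr1.
  have -> : ((1%:R - 2^-1) ^- 2 : R) = 4 by field.
  by lra.
rewrite hnumS; apply: le_trans (lerD IH (lexx _)) _.
set x : R := n.+1%:R; have x1 : 1 <= x by rewrite ler1n.
have xS : n.+2%:R = x + 1 by rewrite -natr1.
rewrite /hint xS.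
clearbody x; suff : (x + 1 - 2^-1) ^- 2 <= x^-1 - (x + 1)^-1 by lra.
have -> : x^-1 - (x + 1)^-1 = (x * (x + 1))^-1 by field; apply/andP; split; rewrite gt_eqF//; lra.
by rewrite lef_pV2 ?posrE; nra.
Qed.

Lemma hnum_ge0 (R : realType) (p n : nat) : 0 <= hnum R p n.
Proof.
by rewrite /hnum big_nat; apply: sumr_ge0 => k /andP[k0 _]; exact: hintV_ge0.
Qed.

Lemma hnum_le (R : realType) (p n : nat) : (1 < p)%N ->
  hnum R p n <= 2 ^+ (p - 2) * 5.
Proof.
move=> p1; apply: (@le_trans _ _ (2 ^+ (p - 2) * hnum R 2 n)).
  rewrite /hnum mulr_sumr; apply: ler_sum_nat => k /andP[k0 _].
  by apply: invX_le => //; exact: hint_ge.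
by rewrite ler_wpM2l ?exprn_ge0// hnum2_le.
Qed.

Lemma sum_hnum (R : realType) (p N : nat) :
  \sum_(1 <= n < N) hint R n ^- p = hnum R p N.-1.
Proof. by case: N => [|N//]; rewrite /hnum !big_geq. Qed.

Lemma cvg_hnum (R : realType) (p : nat) : (1 < p)%N ->
  hnum R p @ \oo --> ttilde R p.
Proof.
move=> p1.
have : cvgn (fun N => \sum_(1 <= n < N) hint R n ^- p).
  apply: (cvg_sum_nonneg (2 ^+ (p - 2) * 5)) => [n|N]; first exact: hintV_ge0.
  by rewrite sum_hnum hnum_le.
move=> cv; have : (fun N => hnum R p N.-1) @ \oo --> ttilde R p.
  by rewrite -(funext (sum_hnum R p)).
by rewrite -cvg_shiftS.
Qed.

Lemma cvg_zeta (R : realType) (s : nat) : (1 < s)%N ->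
  (fun N => \sum_(1 <= n < N) n%:R ^- s) @ \oo --> zeta R s.
Proof.
move=> s1; apply: (cvg_sum_nonneg (2 ^+ (s - 2) * 5)) => [n n0|N].
  by rewrite invr_ge0 exprn_ge0.
apply: le_trans (hnum_le R s N.-1 s1); rewrite -sum_hnum.
by apply: ler_sum_nat => n /andP[n0 _]; exact: natV_le_hintV.
Qed.

Lemma cvg_zetabar (R : realType) (s : nat) : (0 < s)%N ->
  (fun N => \sum_(1 <= n < N) (-1) ^+ n * n%:R ^- s) @ \oo --> zetabar R s.
Proof.
move=> s0; apply: cvg_alternating (cvg_natV R s s0) _ _ => n n0.
  by rewrite invr_ge0 exprn_ge0.
by rewrite lef_pV2 ?posrE ?exprn_gt0 ?ltr0n// lerXn2r ?nnegrE// ler_nat.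
Qed.

Lemma cvg_tbar (R : realType) (s : nat) : (0 < s)%N ->
  (fun N => \sum_(1 <= n < N) (-1) ^+ n * hint R n ^- s) @ \oo --> - tbar R s.
Proof.
move=> s0.
have cv : cvgn (fun N => \sum_(1 <= n < N) (-1) ^+ n * hint R n ^- s).
  apply: cvg_alternating (cvg_hintV R s s0) _ _ => n n0; first exact: hintV_ge0.
  exact: hintV_noninc.
suff -> : tbar R s = - limn (fun N => \sum_(1 <= n < N) (-1) ^+ n * hint R n ^- s).
  by rewrite opprK.
apply: (@sum_ge1_cvg _ _ (fun N => - \sum_(1 <= n < N) (-1) ^+ n * hint R n ^- s)).
  exact: cvgN.
move=> N; rewrite -sumrN.
by apply: eq_big_nat => -[//|n] _; rewrite /= exprS mulN1r mulNr opprK.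
Qed.

(** Convergence may be only conditional. Abel summation works because the weight [hnum] is monotone
    and bounded, hence of bounded total variation. *)
Lemma cvg_Tbar (R : realType) (p q : nat) : (1 < p)%N -> (0 < q)%N ->
  (fun N => \sum_(1 <= n < N) (-1) ^+ n * hint R n ^- q * hnum R p n.-1) @ \oo
  --> Tbar R p q.
Proof.
move=> p1 q0.
pose C : R := 2 ^+ (p - 2) * 5.
have cv : cvgn (fun N => \sum_(1 <= n < N) (-1) ^+ n * hint R n ^- q * hnum R p n.-1).
  apply: (@cvg_sum_of_tail _ _ (fun n => hint R n ^- q * C)).
    rewrite -[X in _ --> X](mul0r C); apply: cvgMr_tmp.
    exact: (cvg_hintV R q q0).
  move=> k N k0 kN.
  apply: le_trans (abel_bound k N kN _ _) _ => [n kn|n kn|].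
  - by rewrite hintV_ge0// (leq_trans k0).
  - by rewrite hintV_noninc// (leq_trans k0).
  apply: (@le_trans _ _ (hint R k ^- q *
     (hnum R p k.-1 + \sum_(k.+1 <= i < N) (hnum R p i.-1 - hnum R p i.-2)))).
    rewrite mulrDr lerD ?(ger0_norm (hnum_ge0 _ _ _))// mulr_sumr.
    apply: ler_sum_nat => -[//|[|i]] /andP[ki _]; first by lia.
    rewrite /= hnumS addrAC subrr add0r ger0_norm ?hintV_ge0//.
    by rewrite ler_wpM2r ?hintV_ge0// hintV_noninc// ltnW.
  (* The variation telescopes, and the bracket collapses to a single value of [hnum]. *)
  rewrite ler_wpM2l ?hintV_ge0// big_add1.
  rewrite (telescope_sumr (fun i => hnum R p i.-1)); last by lia.
  by rewrite addrC subrK hnum_le.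
suff -> : Tbar R p q =
  limn (fun N => \sum_(1 <= n < N) (-1) ^+ n * hint R n ^- q * hnum R p n.-1) by [].
apply: (sum_ge1_cvg cv) => N.
by apply: eq_bigr => n _; rewrite mulrC mulrCA [LHS]mulrC.
Qed.

(** * Bilateral alternating sums and their integer shifts *)

Lemma cvg_shiftnP {R : realType} (m : nat) (u : nat -> R) (l : R) :
  (fun n => u (n + m)%N) @ \oo --> l <-> u @ \oo --> l.
Proof. by rewrite -(cvg_shiftn m u). Qed.

Lemma cvg_shiftSP {R : realType} (u : nat -> R) (l : R) :
  (fun n => u n.+1) @ \oo --> l <-> u @ \oo --> l.
Proof. by rewrite -(cvg_shiftS u). Qed.

Lemma cvg_sumr {R : realType} {I : Type} (r : seq I) (f : I -> nat -> R) (l : I -> R) :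
  (forall i, f i @ \oo --> l i) ->
  (fun N => \sum_(i <- r) f i N) @ \oo --> \sum_(i <- r) l i.
Proof. by move=> fl; apply: (@cvg_big _ _ +%R 0 predT) => //; exact: add_continuous. Qed.

Lemma oppVX {F : fieldType} (x : F) (j : nat) : (- x) ^- j = (-1) ^+ j * x ^- j.
Proof. by rewrite (exprNn x) invfM -signr_odd invr_sign signr_odd. Qed.

(* Minus the sum of [e(x) x^-j] over all half-integers [x]. *)
Definition bisum (R : realType) (j : nat) : R := (1 - (-1) ^+ j) * tbar R j.

Lemma cvg_bisum (R : realType) (j : nat) : (0 < j)%N ->
  (fun N => \sum_(1 <= n < N) (-1) ^+ n * (hint R n ^- j - (- hint R n) ^- j))
    @ \oo --> - bisum R j.
Proof.
move=> j0; rewrite /bisum -mulrN.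
have -> : (fun N => \sum_(1 <= n < N) (-1) ^+ n * (hint R n ^- j - (- hint R n) ^- j))
  = (fun N => (1 - (-1) ^+ j) * \sum_(1 <= n < N) (-1) ^+ n * hint R n ^- j).
  apply/funext => N; rewrite mulr_sumr; apply: eq_bigr => n _.
  by rewrite oppVX; ring.
by apply: cvgMl_tmp; exact: cvg_tbar.
Qed.

(** The substitution [x = y + 1] flips the sign [e] and moves the symmetric window one step to the
    left: one term leaves on the right, one enters on the left. *)
Lemma bisum_shiftS (R : realType) (m j K : nat) :
  \sum_(1 <= n < K.+1) (-1) ^+ n * ((m.+1%:R - hint R n) ^- j - (m.+1%:R + hint R n) ^- j)
  = (-1) ^+ K * (m%:R - hint R K) ^- j + (-1) ^+ K.+1 * (m%:R + hint R K.+1) ^- j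
    - \sum_(1 <= n < K.+1) (-1) ^+ n * ((m%:R - hint R n) ^- j - (m%:R + hint R n) ^- j).
Proof.
elim: K => [|K IH].
  rewrite !big_geq// subr0 expr0 expr1 mul1r mulN1r hintS.
  (* For an empty window the two end terms cancel. *)
  have -> : m%:R - hint R 0 = m%:R + (hint R 0 + 1) by rewrite /hint; field.
  by rewrite subrr.
rewrite !(@big_nat_recr _ _ _ K.+1)//= IH.
have -> : m.+1%:R - hint R K.+1 = m%:R - hint R K by rewrite hintS -natr1; ring.
have -> : m.+1%:R + hint R K.+1 = m%:R + hint R K.+2 by rewrite !hintS -natr1; ring.
by rewrite !exprS; ring.
Qed.

Lemma cvg_sign0 {R : realType} (u : nat -> R) :
  u @ \oo --> (0 : R) -> (fun n => (-1) ^+ n * u n) @ \oo --> (0 : R).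
Proof.
move=> u0; apply/cvgr0Pnorm_lt => e e0.
have : \forall n \near \oo, `|u n| < e by apply: cvgr0_norm_lt.
by apply: filterS => n; rewrite normrM normrX normrN1 expr1n mul1r.
Qed.

Lemma cvg_bisum_shift (R : realType) (m j : nat) : (0 < j)%N ->
  (fun N => \sum_(1 <= n < N) (-1) ^+ n * ((m%:R - hint R n) ^- j - (m%:R + hint R n) ^- j))
    @ \oo --> (-1) ^+ m * bisum R j.
Proof.
move=> j0; elim: m => [|m IH].
  have -> : (fun N => \sum_(1 <= n < N) (-1) ^+ n * ((0%:R - hint R n) ^- j - (0%:R + hint R n) ^- j))
    = (fun N => - \sum_(1 <= n < N) (-1) ^+ n * (hint R n ^- j - (- hint R n) ^- j)).
    apply/funext => N; rewrite -sumrN; apply: eq_bigr => n _.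
    by rewrite sub0r add0r; ring.
  by rewrite expr0 mul1r -[bisum R j]opprK; apply: cvgN; exact: cvg_bisum.
apply/cvg_shiftSP; rewrite (funext (bisum_shiftS R m j)).
have -> : (-1) ^+ m.+1 * bisum R j = 0 + 0 - (-1) ^+ m * bisum R j.
  by rewrite exprS; ring.
apply: cvgB; last exact/(cvg_shiftSP (fun K => \sum_(1 <= n < K) _)).
apply: cvgD.
  (* Moving the index by [m] absorbs the integer: [m - hint (n + m) = - hint n]. *)
  apply/cvg_sign0/(cvg_shiftnP m).
  have -> : (fun n => (m%:R - hint R (n + m)) ^- j) = (fun n => (-1) ^+ j * hint R n ^- j).
    by apply/funext => n; rewrite -oppVX; congr (_ ^- _); rewrite /hint natrD; ring.
  by rewrite -(mulr0 ((-1) ^+ j)); apply: cvgMl_tmp; exact: cvg_hintV.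
apply/(cvg_shiftSP (fun K => (-1) ^+ K * (m%:R + hint R K) ^- j))/cvg_sign0.
have -> : (fun n => (m%:R + hint R n) ^- j) = (fun n => hint R (n + m) ^- j).
  by apply/funext => n; congr (_ ^- _); rewrite /hint natrD; ring.
by apply/(cvg_shiftnP m (fun n => hint R n ^- j)); exact: cvg_hintV.
Qed.

(** * Partial fractions *)

(* With [w = 1/(u + v)], [a = 1/u], [b = 1/v], the expansion of
   [u^-(q+1) v^-(p+1)] is [pfrac w a q p + pfrac w b p q]. *)
Definition pfrac {R : comPzRingType} (w a : R) (q p : nat) : R :=
  \sum_(i < q.+1) 'C(p + i, p)%:R * w ^+ (p + i).+1 * a ^+ (q.+1 - i).

Lemma pfrac0l {R : comPzRingType} (w a : R) (p : nat) : pfrac w a 0 p = w ^+ p.+1 * a.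
Proof. by rewrite /pfrac big_ord1 addn0 binn mul1r subn0. Qed.

Lemma pfracS0 {R : comPzRingType} (w b : R) (p : nat) :
  pfrac w b p.+1 0 = w * (b ^+ p.+2 + pfrac w b p 0).
Proof.
rewrite /pfrac big_ord_recl /= add0n bin0 mul1r expr1 subn0 mulrDr mulr_sumr.
congr (_ + _); apply: eq_bigr => i _.
by rewrite !bin0 !mul1r !add0n /bump/= add1n subSS exprS mulrA.
Qed.

(** Pascal's rule on the binomial coefficients. *)
Lemma pfracSS {R : comPzRingType} (w a : R) (q p : nat) :
  pfrac w a q.+1 p.+1 = w * (pfrac w a q.+1 p + pfrac w a q p.+1).
Proof.
rewrite /pfrac mulrDr.
(* Reindexing by one adds a first term whose coefficient ['C(p, p.+1)] vanishes. *)
have -> : w * (\sum_(i < q.+1) 'C(p.+1 + i, p.+1)%:R * w ^+ (p.+1 + i).+1 * a ^+ (q.+1 - i))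
  = \sum_(i < q.+2) 'C(p + i, p.+1)%:R * w ^+ (p.+1 + i).+1 * a ^+ (q.+2 - i).
  rewrite [RHS]big_ord_recl /= addn0 bin_small// !mul0r add0r mulr_sumr.
  apply: eq_bigr => i _; rewrite /bump/= add1n subSS addSn -addnS.
  by rewrite [w ^+ (p.+1 + i.+1).+1]exprS addSn; ring.
rewrite mulr_sumr -big_split; apply: eq_bigr => i _ /=.
by rewrite addSn binS natrD [w ^+ (p + i).+2]exprS; ring.
Qed.

(** By the hypothesis, [F q p = a ^+ q.+1 * b ^+ p.+1] satisfies
    [F q.+1 p.+1 = w * (F q.+1 p + F q p.+1)], the recurrence of [pfracSS]. A double induction
    remains, with [base] for the edge [q = 0] and, by symmetry, for [p = 0]. *)
Lemma partial_fractions {R : comPzRingType} (w a b : R) (q p : nat) :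
  a * b = w * (a + b) ->
  a ^+ q.+1 * b ^+ p.+1 = pfrac w a q p + pfrac w b p q.
Proof.
have base (x y : R) n : x * y = w * (x + y) ->
    x * y ^+ n.+1 = pfrac w x 0 n + pfrac w y n 0.
  move=> xy; elim: n => [|n IH]; first by rewrite !pfrac0l expr1 xy; ring.
  rewrite pfrac0l in IH; rewrite pfracS0 pfrac0l [w ^+ n.+2]exprS.
  have -> : x * y ^+ n.+2 = w * (x * y ^+ n.+1) + w * y ^+ n.+2.
    by rewrite (exprS y n.+1) mulrA xy; ring.
  by rewrite IH; ring.
move=> ab; elim: q p => [|q IHq] p; first by rewrite expr1 base.
elim: p => [|p IHp]; first by rewrite expr1 mulrC base 1?addrC// mulrC ab addrC.
rewrite !pfracSS -mulrDr.
have -> : a ^+ q.+2 * b ^+ p.+2 = (a * b) * (a ^+ q.+1 * b ^+ p.+1) by rewrite !exprS; ring.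
rewrite ab -mulrA; congr (_ * _).
transitivity (a ^+ q.+2 * b ^+ p.+1 + a ^+ q.+1 * b ^+ p.+2); first by rewrite !exprS; ring.
by rewrite IHp IHq; ring.
Qed.

(** * Summation over [x] first *)

(* The inner sum over [|x| < N - 1/2] for fixed [m]. *)
Definition slice (R : realType) (p q m N : nat) : R :=
  \sum_(1 <= n < N) (-1) ^+ n * (hint R n ^- q * (m%:R - hint R n) ^- p
                                 - (- hint R n) ^- q * (m%:R + hint R n) ^- p).

(** The two families carry opposite signs because [m - x] reverses [x] and [e] is odd; the shift by
    [m] contributes [(-1) ^+ m]. *)
Definition slice_lim (R : realType) (p q m : nat) : R :=
  \sum_(i < q.+1) 'C(p + i, p)%:R * m%:R ^- (p + i).+1 * (- bisum R (q.+1 - i))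
  + \sum_(i < p.+1) 'C(q + i, q)%:R * m%:R ^- (q + i).+1
                    * ((-1) ^+ m * bisum R (p.+1 - i)).

Lemma pfracVB {R : fieldType} (m x y : R) (q p : nat) :
  pfrac m^-1 x^-1 q p - pfrac m^-1 y^-1 q p =
  \sum_(i < q.+1) 'C(p + i, p)%:R * m ^- (p + i).+1 * (x ^- (q.+1 - i) - y ^- (q.+1 - i)).
Proof.
by rewrite /pfrac -sumrB; apply: eq_bigr => i _; rewrite !exprVn -mulrBr.
Qed.

Lemma partial_fractionsV {F : fieldType} (u v m : F) (q p : nat) :
  u != 0 -> v != 0 -> m != 0 -> u + v = m ->
  u ^- q.+1 * v ^- p.+1 = pfrac m^-1 u^-1 q p + pfrac m^-1 v^-1 p q.
Proof.
move=> u0 v0 m0 uvm; rewrite -!exprVn; apply: partial_fractions.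
by rewrite -uvm in m0 *; field; rewrite u0 v0 m0.
Qed.

(** Partial fractions with [u = x], [v = m - x], [u + v = m], at [x = hint n] and [x = - hint n]. *)
Lemma sliceE (R : realType) (p q m N : nat) : (0 < m)%N ->
  slice R p.+1 q.+1 m N =
  \sum_(i < q.+1) 'C(p + i, p)%:R * m%:R ^- (p + i).+1 *
    (\sum_(1 <= n < N) (-1) ^+ n * (hint R n ^- (q.+1 - i) - (- hint R n) ^- (q.+1 - i)))
  + \sum_(i < p.+1) 'C(q + i, q)%:R * m%:R ^- (q + i).+1 *
    (\sum_(1 <= n < N) (-1) ^+ n * ((m%:R - hint R n) ^- (p.+1 - i)
                                     - (m%:R + hint R n) ^- (p.+1 - i))).
Proof.
move=> m0; have m0' : m%:R != 0 :> R by rewrite pnatr_eq0 -lt0n.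
have swap k (c : 'I_k -> R) (g : nat -> 'I_k -> R) :
    \sum_(i < k) c i * (\sum_(1 <= n < N) (-1) ^+ n * g n i) =
    \sum_(1 <= n < N) (-1) ^+ n * \sum_(i < k) c i * g n i.
  under eq_bigr do rewrite mulr_sumr.
  rewrite exchange_big; apply: eq_bigr => n _; rewrite mulr_sumr.
  by apply: eq_bigr => i _; rewrite mulrCA.
rewrite !swap -big_split; apply: eq_bigr => n _ /=.
rewrite -mulrDr -!pfracVB; congr (_ * _).
rewrite (partial_fractionsV (hint R n) (m%:R - hint R n) m%:R)//; first last.
- by rewrite addrC subrK.
- exact: subnat_hint_neq0.
- exact: hint_neq0.
rewrite (partial_fractionsV (- hint R n) (m%:R + hint R n) m%:R)//; first last.
- by rewrite addrC addrK.
- exact: addnat_hint_neq0.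
- by rewrite oppr_eq0 hint_neq0.
by ring.
Qed.

Lemma cvg_slice (R : realType) (p q m : nat) : (0 < m)%N ->
  slice R p.+1 q.+1 m @ \oo --> slice_lim R p q m.
Proof.
move=> m0; rewrite (funext (fun N => sliceE R p q m N m0)).
apply: cvgD; apply: cvg_sumr => i; apply: cvgMl_tmp.
  by apply: cvg_bisum; rewrite subn_gt0.
by apply: cvg_bisum_shift; rewrite subn_gt0.
Qed.

(** The shift sign [(-1) ^+ m] turns the second family into [zetabar]. The first has exponents at
    least 2 since [0 < p], so its [zeta] series converge. *)
Lemma cvg_sum_slice_lim (R : realType) (p q : nat) : (0 < p)%N ->
  (fun M => \sum_(1 <= m < M) slice_lim R p q m) @ \oo -->
  \sum_(i < q.+1) 'C(p + i, p)%:R * zeta R (p + i).+1 * (- bisum R (q.+1 - i))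
  + \sum_(i < p.+1) 'C(q + i, q)%:R * zetabar R (q + i).+1 * bisum R (p.+1 - i).
Proof.
move=> p0.
have -> : (fun M => \sum_(1 <= m < M) slice_lim R p q m) = (fun M =>
  \sum_(i < q.+1) 'C(p + i, p)%:R * (\sum_(1 <= m < M) m%:R ^- (p + i).+1)
                  * (- bisum R (q.+1 - i))
  + \sum_(i < p.+1) 'C(q + i, q)%:R * (\sum_(1 <= m < M) (-1) ^+ m * m%:R ^- (q + i).+1)
                  * bisum R (p.+1 - i)).
  apply/funext => M; rewrite /slice_lim big_split /=.
  congr (_ + _); rewrite exchange_big; apply: eq_bigr => i _;
    rewrite mulr_sumr mulr_suml; apply: eq_bigr => m _; ring.
apply: cvgD; apply: cvg_sumr => i; apply: cvgMr_tmp; apply: cvgMl_tmp.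
  by apply: cvg_zeta; rewrite ltnS (leq_trans p0)// leq_addr.
exact: cvg_zetabar.
Qed.

(** * Tails over [m], bounded uniformly in the truncation of [x] *)

(* The tails of the sums over [m >= M] of [(m - x)^-p], at [x = n - 1/2] and
   at [x = -(n - 1/2)]. *)
Definition tailp (R : realType) (p M n : nat) : R :=
  ttilde R p + (-1) ^+ p * hnum R p n.-1 - \sum_(1 <= m < M) (m%:R - hint R n) ^- p.

Definition tailm (R : realType) (p M n : nat) : R :=
  ttilde R p - hnum R p n - \sum_(1 <= m < M) (m%:R + hint R n) ^- p.

Lemma tailp1 (R : realType) (p M : nat) : tailp R p M 1 = ttilde R p - hnum R p M.-1.
Proof.
rewrite /tailp /= hnum0 mulr0 addr0 -sum_hnum; congr (_ - _).
by apply: eq_bigr => m _; congr (_ ^- _); rewrite /hint; field.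
Qed.

Lemma tailm1 (R : realType) (p K : nat) : tailm R p K.+1 1 = ttilde R p - hnum R p K.+1.
Proof.
rewrite /tailm /hnum big_nat1 (@big_ltn _ _ _ 1 K.+2)// [in RHS]big_add1 /= opprD addrA.
congr (_ - _); apply: eq_bigr => m _; congr (_ ^- _).
by rewrite /hint -[in RHS]natr1; field.
Qed.

(** Raising [n] by one shifts the progression [m - hint n] by one, so consecutive tails differ by
    one boundary term. These differences are the variations needed by [abel_bound]. *)
Lemma tailpS (R : realType) (p K n : nat) : (0 < n)%N ->
  tailp R p K.+1 n.+1 - tailp R p K.+1 n = (K.+1%:R - hint R n.+1) ^- p.
Proof.
case: n => // n _; rewrite /tailp /= hnumS.
have -> : \sum_(1 <= m < K.+1) (m%:R - hint R n.+2) ^- p =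
  (- hint R n.+1) ^- p - (K%:R - hint R n.+1) ^- p
  + \sum_(1 <= m < K.+1) (m%:R - hint R n.+1) ^- p.
  elim: K => [|K IH]; first by rewrite !big_geq// sub0r subrr addr0.
  rewrite !(@big_nat_recr _ _ _ K.+1)//= IH.
  have -> : K.+1%:R - hint R n.+2 = K%:R - hint R n.+1.
    by rewrite (hintS _ n.+1) -natr1; ring.
  by ring.
have -> : K.+1%:R - hint R n.+2 = K%:R - hint R n.+1.
  by rewrite (hintS _ n.+1) -natr1; ring.
by rewrite oppVX; ring.
Qed.

Lemma tailmS (R : realType) (p K n : nat) :
  tailm R p K.+1 n.+1 - tailm R p K.+1 n = - (K.+1%:R + hint R n) ^- p.
Proof.
rewrite /tailm hnumS.
have -> : \sum_(1 <= m < K.+1) (m%:R + hint R n.+1) ^- p =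
  (K.+1%:R + hint R n) ^- p - hint R n.+1 ^- p
  + \sum_(1 <= m < K.+1) (m%:R + hint R n) ^- p.
  elim: K => [|K IH].
    by rewrite !big_geq// hintS [1%:R + _]addrC subrr addr0.
  rewrite !(@big_nat_recr _ _ _ K.+1)//= IH.
  have -> : K.+1%:R + hint R n.+1 = K.+2%:R + hint R n.
    by rewrite hintS -[K.+2%:R]natr1; ring.
  by ring.
by ring.
Qed.

(** The numbers [M - hint k] are distinct half-integers; the negative and the positive ones each
    contribute at most 5 by [hnum2_le]. *)
Lemma sum_sqV_le (R : realType) (M N : nat) :
  \sum_(1 <= k < N) (M%:R - hint R k) ^- 2 <= 10.
Proof.
have h2 x : 0 <= x ^- 2 :> R by rewrite invr_ge0 sqr_ge0.
suff H : \sum_(1 <= k < N) (M%:R - hint R k) ^- 2 <= hnum R 2 N.-1 + hnum R 2 M.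
  apply: (le_trans H); apply: (@le_trans _ _ (5 + 5)); last by rewrite -natrD.
  by apply: lerD; exact: hnum2_le.
elim: M => [|M IH].
  rewrite -sum_hnum hnum0 addr0.
  by apply: ler_sum => k _; rewrite sub0r sqrrN.
case: N IH => [|N] IH; first by rewrite big_geq// addr_ge0// hnum_ge0.
rewrite hnumS addrA; apply: le_trans (lerD IH (lexx _)); rewrite big_add1 /=.
rewrite (eq_bigr (fun k => (M%:R - hint R k) ^- 2)); last first.
  by move=> k _; congr (_ ^- _); rewrite hintS -natr1; ring.
have -> : hint R M.+1 ^- 2 = (M%:R - hint R 0) ^- 2.
  by congr (_ ^- _); rewrite /hint -natr1; field.
rewrite addrC -big_ltn// big_nat_recr//= lerDl; exact: h2.
Qed.

(* With [a = n - 1/2] and [d = |M - a|], from [M <= a + d]: [a^-1 d^-2 <= M^-1 (d^-2 + a^-1 d^-1)], and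
   [a^-1 d^-1 <= a^-2 + d^-2]. *)
Lemma sum_conv_le (R : realType) (p q K N : nat) : (1 < p)%N -> (0 < q)%N ->
  \sum_(1 <= n < N) hint R n ^- q * `|K.+1%:R - hint R n| ^- p
  <= 2 ^+ (q - 1) * 2 ^+ (p - 2) * 25 / K.+1%:R.
Proof.
move=> p1 q0; set M : R := K.+1%:R.
have M0 : 0 < M by rewrite ltr0n.
apply: (@le_trans _ _ (\sum_(1 <= n < N) 2 ^+ (q - 1) * 2 ^+ (p - 2) / M *
    (hint R n ^- 2 + 2 * (M - hint R n) ^- 2))).
  apply: ler_sum_nat => n /andP[n0 _].
  have a2 := hint_ge R n n0; have d2 := subnat_hint_ge R K.+1 n.
  rewrite -/M in d2; rewrite -(real_normK (num_real (M - hint R n))).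
  have Mad : M <= hint R n + `|M - hint R n|.
    by have := ler_norm (M - hint R n); lra.
  move: (hint R n) (`|M - hint R n|) a2 d2 Mad => a d a2 d2 Mad.
  have a0 : 0 < a by lra.
  have d0 : 0 < d by lra.
  apply: (@le_trans _ _ ((2 ^+ (q - 1) * a ^- 1) * (2 ^+ (p - 2) * d ^- 2))).
    by apply: ler_pM; rewrite ?invr_ge0 ?exprn_ge0 ?(ltW a0) ?(ltW d0)//; exact: invX_le.
  rewrite mulrACA -[leRHS]mulrA ler_wpM2l ?mulr_ge0 ?exprn_ge0//.
  rewrite -ler_pdivrMl ?invr_gt0// invrK expr1.
  apply: (@le_trans _ _ ((a + d) * (a^-1 * d ^- 2))).
    by rewrite ler_wpM2r// mulr_ge0 ?invr_ge0 ?exprn_ge0 ?(ltW a0) ?(ltW d0).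
  have -> : (a + d) * (a^-1 * d ^- 2) = d^-1 ^+ 2 + a^-1 * d^-1.
    by field; rewrite !gt_eqF.
  rewrite -!exprVn.
  by have := sqr_ge0 (a^-1 - d^-1); nra.
rewrite -mulr_sumr big_split /= -mulr_sumr sum_hnum.
rewrite [leRHS]mulrAC ler_wpM2l//.
  by rewrite !mulr_ge0 ?exprn_ge0// invr_ge0 ltW.
(* The constant is [25 = 5 + 2 * 10]. *)
have := hnum2_le R N.-1; have := sum_sqV_le R K.+1 N; rewrite -/M.
by move: (hnum _ _ _) (\sum_(1 <= i < N) _) => x y; lra.
Qed.

(** Abel summation with weight [tailp]: its value at [n = 1] is a tail of [ttilde], and its
    variation is controlled by [sum_conv_le]. The bound is free of [N]. *)
Lemma alt_tailp_le (R : realType) (p q K N : nat) : (1 < p)%N -> (0 < q)%N ->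
  `|\sum_(1 <= n < N) (-1) ^+ n * hint R n ^- q * tailp R p K.+1 n| <=
  2 ^+ q * `|ttilde R p - hnum R p K| + 2 ^+ (q - 1) * 2 ^+ (p - 2) * 25 / K.+1%:R.
Proof.
move=> p1 q0.
have [N1|N1] := leqP N 1.
  by rewrite big_geq// normr0 addr_ge0// ?divr_ge0 ?mulr_ge0 ?exprn_ge0.
apply: le_trans (abel_bound 1 N N1 _ _) _ => [n|n n0|]; first exact: hintV_ge0.
  exact: hintV_noninc.
rewrite tailp1 /=; apply: lerD.
  by rewrite ler_wpM2r// (le_trans (invX_le _ 0 q (hint_ge R 1 isT) _))// subn0 invr1 mulr1.
apply: le_trans (sum_conv_le R p q K N p1 q0).
(* The variation sum starts at 2; the missing term [n = 1] is nonnegative. *)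
rewrite (@big_ltn _ _ _ 1 N)// -[leLHS]add0r; apply: lerD.
  by rewrite mulr_ge0 ?hintV_ge0// invr_ge0 exprn_ge0.
apply: ler_sum_nat => -[|n] // /andP[n0 _].
by rewrite /= tailpS// normfV normrX.
Qed.

Lemma alt_tailm_le (R : realType) (p q K N : nat) : (1 < p)%N -> (0 < q)%N ->
  `|\sum_(1 <= n < N) (-1) ^+ n * hint R n ^- q * tailm R p K.+1 n| <=
  2 ^+ q * `|ttilde R p - hnum R p K.+1| + 2 ^+ (q - 1) * 2 ^+ (p - 2) * 25 / K.+1%:R.
Proof.
move=> p1 q0.
have [N1|N1] := leqP N 1.
  by rewrite big_geq// normr0 addr_ge0// ?divr_ge0 ?mulr_ge0 ?exprn_ge0.
apply: le_trans (abel_bound 1 N N1 _ _) _ => [n|n n0|]; first exact: hintV_ge0.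
  exact: hintV_noninc.
rewrite tailm1 /=; apply: lerD.
  by rewrite ler_wpM2r// (le_trans (invX_le _ 0 q (hint_ge R 1 isT) _))// subn0 invr1 mulr1.
apply: le_trans (sum_conv_le R p q K N p1 q0).
rewrite (@big_ltn _ _ _ 1 N)// -[leLHS]add0r; apply: lerD.
  by rewrite mulr_ge0 ?hintV_ge0// invr_ge0 exprn_ge0.
apply: ler_sum_nat => -[|n] // /andP[n0 _].
rewrite /= tailmS normrN normfV normrX ler_wpM2l ?hintV_ge0//.
have d2 := subnat_hint_ge R K.+1 n.+1.
have d0 : 0 < `|K.+1%:R - hint R n.+1| by apply: lt_le_trans d2; rewrite invr_gt0.
(* Replacing the distance by a smaller one lets [sum_conv_le] serve the negative [x] too. *)
have dl : `|K.+1%:R - hint R n.+1| <= `|K.+1%:R + hint R n|.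
  have := hint_ge R n n0; have : (1 : R) <= K.+1%:R by rewrite ler1n.
  rewrite hintS; move: (hint R n) (K.+1%:R) => a M M1 a2.
  by rewrite [leRHS]ger0_norm ?ler_norml; [apply/andP; split|]; lra.
rewrite lef_pV2 ?posrE ?exprn_gt0 ?(lt_le_trans d0)//.
by rewrite lerXn2r// nnegrE.
Qed.

(** * Summation over [m] first, and exchange of the two limits *)

(* The double sum over [|x| < N - 1/2], with the sum over [m] carried out. *)
Definition kersum (R : realType) (p q N : nat) : R :=
  \sum_(1 <= n < N) (-1) ^+ n * hint R n ^- q * (ttilde R p + (-1) ^+ p * hnum R p n.-1)
  - (-1) ^+ q * \sum_(1 <= n < N) (-1) ^+ n * hint R n ^- q * (ttilde R p - hnum R p n).

Lemma cvg_kersum (R : realType) (p q : nat) : (1 < p)%N -> (0 < q)%N ->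
  kersum R p q @ \oo -->
  ttilde R p * (1 - (-1) ^+ q) * (- tbar R q) + ((-1) ^+ p + (-1) ^+ q) * Tbar R p q
  + (-1) ^+ q * (- tbar R (p + q)).
Proof.
move=> p1 q0.
have -> : kersum R p q = (fun N =>
  ttilde R p * (1 - (-1) ^+ q) * (\sum_(1 <= n < N) (-1) ^+ n * hint R n ^- q)
  + ((-1) ^+ p + (-1) ^+ q) *
    (\sum_(1 <= n < N) (-1) ^+ n * hint R n ^- q * hnum R p n.-1)
  + (-1) ^+ q * \sum_(1 <= n < N) (-1) ^+ n * hint R n ^- (p + q)).
  apply/funext => N; rewrite /kersum !mulr_sumr -sumrB -!big_split /=.
  (* [hnumS] splits off the last term of [hnum], which is the source of [tbar (p + q)]. *)
  apply: eq_big_nat => -[//|n] _; rewrite /= hnumS exprD invfM; ring.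
apply: cvgD; first apply: cvgD.
- by apply: cvgMl_tmp; exact: cvg_tbar.
- by apply: cvgMl_tmp; exact: cvg_Tbar.
- by apply: cvgMl_tmp; apply: cvg_tbar; rewrite addn_gt0 q0 orbT.
Qed.

Lemma kersum_sub_slices (R : realType) (p q M N : nat) :
  kersum R p q N - \sum_(1 <= m < M) slice R p q m N =
  \sum_(1 <= n < N) (-1) ^+ n * hint R n ^- q * tailp R p M n
  - (-1) ^+ q * \sum_(1 <= n < N) (-1) ^+ n * hint R n ^- q * tailm R p M n.
Proof.
rewrite /slice exchange_big /kersum !mulr_sumr -!sumrB; apply: eq_bigr => n _ /=.
rewrite -mulr_sumr sumrB -!mulr_sumr /tailp /tailm oppVX; ring.
Qed.

Definition slice_err (R : realType) (p q K : nat) : R :=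
  2 ^+ q * `|ttilde R p - hnum R p K| + 2 ^+ q * `|ttilde R p - hnum R p K.+1|
  + 2 * (2 ^+ (q - 1) * 2 ^+ (p - 2) * 25 / K.+1%:R).

Lemma kersum_slices_le (R : realType) (p q K N : nat) : (1 < p)%N -> (0 < q)%N ->
  `|kersum R p q N - \sum_(1 <= m < K.+1) slice R p q m N| <= slice_err R p q K.
Proof.
move=> p1 q0; rewrite kersum_sub_slices (le_trans (ler_normB _ _))//.
rewrite normrM normrX normrN1 expr1n mul1r.
apply: le_trans (lerD (alt_tailp_le R p q K N p1 q0) (alt_tailm_le R p q K N p1 q0)) _.
by rewrite /slice_err addrACA [2 * (_ / _)]mulr_natl mulr2n.
Qed.

Lemma cvg_slice_err (R : realType) (p q : nat) : (1 < p)%N ->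
  slice_err R p q @ \oo --> (0 : R).
Proof.
move=> p1.
have h0 : (fun K => `|ttilde R p - hnum R p K|) @ \oo --> (0 : R).
  rewrite -(@normr0 _ R) -(subrr (ttilde R p)).
  by apply: cvg_norm; apply: cvgB; [exact: cvg_cst|exact: cvg_hnum].
have -> : (0 : R) = 2 ^+ q * 0 + 2 ^+ q * 0 + 2 * (2 ^+ (q - 1) * 2 ^+ (p - 2) * 25 * 0).
  by rewrite !mulr0 !addr0.
apply: cvgD; first apply: cvgD.
- exact: cvgMl_tmp.
- apply: cvgMl_tmp; exact/(cvg_shiftSP (fun K => `|ttilde R p - hnum R p K|)).
- by apply: cvgMl_tmp; apply: cvgMl_tmp; exact: cvg_harmonic.
Qed.

Lemma cvg_norm_le {R : realType} {u : nat -> R} {l e : R} :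
  u @ \oo --> l -> (forall n, `|u n| <= e) -> `|l| <= e.
Proof.
move=> ul ue; apply: (@ler_cvg_to _ \oo _ _ (fun n => `|u n|) (fun=> e)).
- exact: cvg_norm.
- exact: cvg_cst.
- by near=> n.
Unshelve. all: by end_near. Qed.

(** For fixed [K], letting [N] tend to infinity preserves the uniform bound [slice_err]; letting [K]
    tend to infinity then forces the two evaluations to agree. *)
Lemma kersum_eval (R : realType) (p q : nat) : (0 < p)%N ->
  ttilde R p.+1 * (1 - (-1) ^+ q.+1) * (- tbar R q.+1)
  + ((-1) ^+ p.+1 + (-1) ^+ q.+1) * Tbar R p.+1 q.+1
  + (-1) ^+ q.+1 * (- tbar R (p.+1 + q.+1))
  = \sum_(i < q.+1) 'C(p + i, p)%:R * zeta R (p + i).+1 * (- bisum R (q.+1 - i))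
  + \sum_(i < p.+1) 'C(q + i, q)%:R * zetabar R (q + i).+1 * bisum R (p.+1 - i).
Proof.
move=> p0; set D := LHS; set G := RHS; apply/eqP; rewrite -subr_eq0 -normr_eq0 eq_le normr_ge0 andbT.
have DF K : `|D - \sum_(1 <= m < K.+1) slice_lim R p q m| <= slice_err R p.+1 q.+1 K.
  apply: (@cvg_norm_le _
    (fun N => kersum R p.+1 q.+1 N - \sum_(1 <= m < K.+1) slice R p.+1 q.+1 m N)).
    apply: cvgB; first exact: cvg_kersum.
    (* Writing the index as a successor makes every [m] positive, as [cvg_slice] requires. *)
    under eq_cvg do rewrite big_add1.
    rewrite big_add1.
    by apply: cvg_sumr => m; exact: cvg_slice.
  by move=> N; exact: kersum_slices_le.
apply: (@ler_cvg_to _ \oo _ _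
  (fun K => `|D - \sum_(1 <= m < K.+1) slice_lim R p q m|) (slice_err R p.+1 q.+1)).
- apply: cvg_norm; apply: cvgB; first exact: cvg_cst.
  apply/(cvg_shiftSP (fun K => \sum_(1 <= m < K) slice_lim R p q m)).
  exact: cvg_sum_slice_lim.
- exact: cvg_slice_err.
- by near=> K.
Unshelve. all: by end_near. Qed.

(** * Reindexing and the final identity *)

(** With [i = k2] and [j = q.+1 - i], the factor [1 - (-1) ^+ j] is 2 when [j = 2 * k1 + 1] is odd
    and 0 otherwise. *)
Lemma sum_diagonal {R : realType} (G : nat -> nat -> R) (q : nat) :
  2 * \sum_(k1 < q.+1) \sum_(k2 < q.+1 | (2 * k1 + k2 == q)%N) G k2 (2 * k1 + 1)%N =
  \sum_(i < q.+1) (1 - (-1) ^+ (q.+1 - i)) * G i (q.+1 - i)%N.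
Proof.
rewrite (exchange_big_dep xpredT)//= mulr_sumr; apply: eq_bigr => i _.
have iq := ltn_ord i; have [odd_i|even_i] := boolP (odd (q.+1 - i)).
  have lt_h : ((q.+1 - i)./2 < q.+1)%N by lia.
  rewrite (big_pred1 (Ordinal lt_h)) /=; last first.
    by move=> k /=; apply/eqP/eqP => [ki|-> /=]; [apply/val_inj => /=|]; lia.
  have -> : (2 * (q.+1 - i)./2 + 1 = q.+1 - i)%N by lia.
  by rewrite -signr_odd odd_i expr1 opprK.
rewrite big_pred0; last by move=> k; apply/negP => /eqP ki; lia.
by rewrite -signr_odd (negbTE even_i) expr0 subrr mulr0 mul0r.
Qed.

Theorem theorem3p2 (R : realType) (p q : nat) (hp : (1 < p)%N) (hq : (0 < q)%N) :
  (1 + (-1) ^+ (p + q)) * Tbar R p q =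
    (-1) ^+ (p + q) * tbar R (p + q)
    + (-1) ^+ p * (1 - (-1) ^+ q) * ttilde R p * tbar R q
    + (-1) ^+ p * (\sum_(0 <= k < p)
        ((-1) ^+ k + 1) * 'C(p + q - k - 2, q - 1)%:R
          * tbar R (k + 1) * zetabar R (p + q - k - 1))
    - 2 * (-1) ^+ p * (\sum_(k1 < q) \sum_(k2 < q | (2 * k1 + k2 == q - 1)%N)
        'C(p + k2 - 1, p - 1)%:R
          * tbar R (2 * k1 + 1) * zeta R (p + k2)).
Proof.
case: p hp => // p hp; case: q hq => // q hq.
have eval := kersum_eval R p q hp.
(* Reversing the order of summation, [k = p - i], matches the [zetabar] sum of [eval]. *)
rewrite big_mkord (reindex_inj rev_ord_inj) /=.
rewrite (eq_bigr (fun i : 'I_p.+1 =>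
  'C(q + i, q)%:R * zetabar R (q + i).+1 * bisum R (p.+1 - i))); last first.
  move=> i _; have ip := ltn_ord i.
  have -> : (p.+1 + q.+1 - (p.+1 - i.+1) - 2 = q + i)%N by lia.
  have -> : (p.+1 + q.+1 - (p.+1 - i.+1) - 1 = (q + i).+1)%N by lia.
  have -> : (p.+1 - i.+1 + 1 = p.+1 - i)%N by lia.
  have -> : (p.+1 - i = (p.+1 - i.+1).+1)%N by lia.
  (* Here [(-1) ^+ k + 1] is the factor [1 - (-1) ^+ k.+1] of [bisum]. *)
  by rewrite /bisum exprS subn1 /=; ring.
rewrite [2 * (-1) ^+ p.+1]mulrC -[(-1) ^+ p.+1 * 2 * _]mulrA.
rewrite (eq_bigr (fun k1 : 'I_q.+1 => \sum_(k2 < q.+1 | (2 * k1 + k2 == q)%N)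
   'C(p + k2, p)%:R * tbar R (2 * k1 + 1) * zeta R (p + k2).+1)); last first.
  by move=> k1 _; apply: eq_big => k2; rewrite !subn1// addSn.
rewrite (sum_diagonal (fun k2 j => 'C(p + k2, p)%:R * tbar R j * zeta R (p + k2).+1)).
rewrite (eq_bigr (fun i : 'I_q.+1 =>
  - ('C(p + i, p)%:R * zeta R (p + i).+1 * (- bisum R (q.+1 - i))))); last first.
  by move=> i _; rewrite /bisum; ring.
rewrite sumrN.
(* The claim is [eval] multiplied by the sign [s = (-1) ^+ p.+1]: since [s * s = 1], the left factor
   [1 + s * t] equals [s * (s + t)]. *)
have ss : (-1) ^+ p.+1 * (-1) ^+ p.+1 = 1 :> R by rewrite -exprMn mulrNN mulr1 expr1n.
rewrite -{1}ss [(-1) ^+ (p.+1 + q.+1)]exprD -mulrDr.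
move: eval; set T := Tbar _ _ _; set X := \sum_(i < q.+1) _; set Y := \sum_(i < p.+1) _.
move: ((-1) ^+ p.+1) ((-1) ^+ q.+1) => s t eval.
have -> : s * (s + t) * T = s * ((s + t) * T) by ring.
have -> : (s + t) * T = X + Y + ttilde R p.+1 * (1 - t) * tbar R q.+1
    + t * tbar R (p.+1 + q.+1) by rewrite -eval; ring.
by ring.
Qed.
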